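(* Let $p$ be a prime and let $e_1,\ldots,e_s$ be positive integers. Then the free product $\Gamma=C_{e_1}\ast\dots\ast C_{e_s}\ast F_r$ has $p$-deficiency $$\mathrm{def}_p\,\Gamma=r-1+\sum_{i=1}^s\left(1-p^{-\nu_p(e_i)}\right).$$
   Context: $C_e$ is the cyclic group of order $e$, $F_r$ is the free group of rank $r$, and for an integer $n$, $\nu_p(n)$ is the largest $k$ such that $p^k$ divides $n$. Let $F$ be the free group on a finite set $X$. For a non-trivial $w\in F$, the $p$-valuation $\nu_p(w)$ is the largest integer $k$ such that $w=v^{p^k}$ for some $v\in F$. For a presentation $\langle X|R\rangle$ with $X$ finite ($R\subseteq F$ possibly infinite) its $p$-deficiency is $\mathrm{def}_p\langle X|R\rangle=|X|-1-\sum_{r\in R}p^{-\nu_p(r)}$ (equal to $-\infty$ if the sum diverges). The $p$-deficiency $\mathrm{def}_p\,\Gamma$ of a finitely generated group $\Gamma$ is the supremum of $\mathrm{def}_p\langle X|R\rangle$ over all presentations $\langle X|R\rangle$ of $\Gamma$ with a finite generating set $X$. *)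

(* Defs.v *)
(* MathComp world, with MathComp-Analysis for classical sets, extended reals
   and sums over arbitrary sets. *)
From HB Require Import structures.
From mathcomp Require Import all_boot all_order all_algebra.
From mathcomp Require Import boolp classical_sets reals constructive_ereal.
From mathcomp Require Import ereal esum.

Set Implicit Arguments.
Unset Strict Implicit.
Unset Printing Implicit Defensive.

Import Order.TTheory GRing.Theory Num.Theory.

Local Open Scope group_scope.
Local Open Scope classical_set_scope.
Local Open Scope quotient_scope.

(** * Groups of words modulo rewriting rules

    Free groups and free products are both obtained as words over an alphabet
    modulo the least congruence (for concatenation) containing some rules. *)

Section WordCongruence.
Context {A : Type} (rule : seq A -> seq A -> Prop).

Inductive word_congr : seq A -> seq A -> Prop :=
| WCRule u v of rule u v : word_congr u v
| WCRefl u : word_congr u u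
| WCSym u v of word_congr u v : word_congr v u
| WCTrans u v w of word_congr u v & word_congr v w : word_congr u w
| WCCat u u' v v' of word_congr u u' & word_congr v v' :
    word_congr (u ++ v) (u' ++ v').

End WordCongruence.

(* The two laws say that every letter has a formal inverse letter, which is
   what makes the quotient monoid of words a group. *)
Record wordSystem := WordSystem {
  letter : choiceType;
  letter_inv : letter -> letter;
  word_rule : seq letter -> seq letter -> Prop;
  letter_mulgV : forall a, word_congr word_rule [:: a; letter_inv a] [::];
  letter_mulVg : forall a, word_congr word_rule [:: letter_inv a; a] [::]
}.

Section WordGroup.
Variable W : wordSystem.
Implicit Types u v w : seq (letter W).

Let congr := word_congr (@word_rule W).

Definition word_equiv : rel (seq (letter W)) := fun u v => `[< congr u v >].

Let word_equiv_refl : reflexive word_equiv.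
Proof. by move=> u; apply/asboolP; exact: WCRefl. Qed.

Let word_equiv_sym : symmetric word_equiv.
Proof. by move=> u v; apply/asboolP/asboolP; exact: WCSym. Qed.

Let word_equiv_trans : transitive word_equiv.
Proof. by move=> v u w /asboolP uv /asboolP vw; apply/asboolP/(WCTrans uv vw). Qed.

Canonical word_equivRel :=
  EquivRel word_equiv word_equiv_refl word_equiv_sym word_equiv_trans.

Definition word_group : Type := {eq_quot word_equivRel}.
HB.instance Definition _ : EqQuotient _ word_equivRel word_group :=
  EqQuotient.on word_group.
HB.instance Definition _ := Choice.on word_group.

Definition word_class u : word_group := \pi u.

Lemma word_classP u v : word_class u = word_class v <-> congr u v.
Proof. by split=> [/eqmodP/asboolP | uv]; last by apply/eqmodP/asboolP. Qed.

Lemma word_class_repr (x : word_group) : word_class (repr x) = x.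
Proof. exact: reprK. Qed.

Definition word_one : word_group := word_class [::].
Definition word_mul (x y : word_group) := word_class (repr x ++ repr y).
Definition word_inv (x : word_group) :=
  word_class (rev (map (@letter_inv W) (repr x))).

Lemma word_mulE u v : word_mul (word_class u) (word_class v) = word_class (u ++ v).
Proof. by apply/word_classP/WCCat; apply/word_classP; rewrite word_class_repr. Qed.

Let word_mulA : associative word_mul.
Proof.
move=> x y z; rewrite -(word_class_repr x) -(word_class_repr y).
by rewrite -(word_class_repr z) !word_mulE catA.
Qed.

Let word_mul1 : left_id word_one word_mul.
Proof. by move=> x; rewrite -(word_class_repr x) word_mulE. Qed.

Let word_mulr1 : right_id word_one word_mul.
Proof. by move=> x; rewrite -(word_class_repr x) word_mulE cats0. Qed.

Let word_mulV : left_inverse word_one word_inv word_mul.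
Proof.
move=> x; rewrite -{2}(word_class_repr x) word_mulE; apply/word_classP.
elim: (repr x) => [|a u IHu] /=; first exact: WCRefl.
rewrite rev_cons -cats1 -catA -[_ ++ a :: u]/([:: _; a] ++ u).
apply: WCTrans IHu; apply: WCCat (WCRefl _ _) _.
exact: WCCat (letter_mulVg a) (WCRefl _ _).
Qed.

Let word_mulrV : right_inverse word_one word_inv word_mul.
Proof.
move=> x; rewrite -{1}(word_class_repr x) word_mulE; apply/word_classP.
elim/last_ind: (repr x) => [|u a IHu] /=; first exact: WCRefl.
rewrite map_rcons rev_rcons -cats1 -catA.
apply: WCTrans IHu; apply: WCCat (WCRefl _ _) _.
exact: WCCat (letter_mulgV a) (WCRefl _ _).
Qed.

HB.instance Definition _ := isGroup.Build word_group
  word_mulA word_mul1 word_mulr1 word_mulV word_mulrV.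

End WordGroup.

(** * Free groups *)

Section FreeGroup.
Variable X : choiceType.

(* The letter (x, b) stands for x if b is true, and for x^-1 otherwise. *)
Definition free_inv (a : X * bool) : X * bool := (a.1, ~~ a.2).

Variant free_rule : seq (X * bool) -> seq (X * bool) -> Prop :=
| FreeCancel a : free_rule [:: a; free_inv a] [::].

Let free_mulgV a : word_congr free_rule [:: a; free_inv a] [::].
Proof. exact/WCRule/FreeCancel. Qed.

Let free_mulVg a : word_congr free_rule [:: free_inv a; a] [::].
Proof.
by case: a => x []; exact: (free_mulgV (x, _)).
Qed.

Definition free_system := WordSystem free_mulgV free_mulVg.

Definition free_group : groupType := word_group free_system.

Definition free_gen (x : X) : free_group :=
  word_class (W := free_system) [:: (x, true)].

End FreeGroup.

(** * Free products of families of groups *)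

Section FreeProduct.
Variables (I : choiceType) (G : I -> groupType).

Let syllable : choiceType := {i : I & G i}.

Definition syllable_inv (a : syllable) : syllable :=
  Tagged (fun i => G i : Type) (tagged a)^-1.

Variant free_prod_rule : seq syllable -> seq syllable -> Prop :=
| FreeProdOne i : free_prod_rule [:: Tagged (fun i => G i : Type) (1 : G i)] [::]
| FreeProdMul i (x y : G i) :
    free_prod_rule [:: Tagged (fun i => G i : Type) x;
                       Tagged (fun i => G i : Type) y]
                   [:: Tagged (fun i => G i : Type) (x * y)].

Let free_prod_mulgV a : word_congr free_prod_rule [:: a; syllable_inv a] [::].
Proof.
case: a => i x; apply: WCTrans (WCRule (FreeProdMul _ _)) _.
by rewrite /= mulgV; exact/WCRule/FreeProdOne.
Qed.

Let free_prod_mulVg a : word_congr free_prod_rule [:: syllable_inv a; a] [::].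
Proof.
case: a => i x; apply: WCTrans (WCRule (FreeProdMul _ _)) _.
by rewrite /= mulVg; exact/WCRule/FreeProdOne.
Qed.

Definition free_prod_system := WordSystem free_prod_mulgV free_prod_mulVg.

Definition free_prod : groupType := word_group free_prod_system.

Definition free_prod_in (i : I) (x : G i) : free_prod :=
  word_class (W := free_prod_system) [:: Tagged (fun i => G i : Type) x].

End FreeProduct.

(* C_e for e > 0, as the additive group of integers modulo e. The predecessor is
   there because only 'I_n.+1 carries a group structure. *)
Definition cyclic_group (e : nat) : groupType := 'I_e.-1.+1.

(* C_{e_1} * ... * C_{e_s} * F_r, the index None being that of the factor F_r. *)
Definition cyclic_free_prod (s r : nat) (e : 'I_s -> nat) : groupType :=
  free_prod (fun j : option 'I_s =>
    if j is Some i then cyclic_group (e i) else free_group 'I_r).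

(** * Presentations *)

Definition normal_subgroup (G : groupType) (N : set G) : Prop :=
  [/\ N 1, forall x y, N x -> N y -> N (x * y), forall x, N x -> N x^-1
    & forall x y, N x -> N (x ^ y)].

Definition normal_closure (G : groupType) (Y : set G) : set G :=
  smallest (@normal_subgroup G) Y.

Definition is_presentation (Gamma : groupType) (X : choiceType)
    (Rel : set (free_group X)) : Prop :=
  exists f : {multiplicative free_group X -> Gamma},
    range f = setT /\ f @^-1` [set 1] = normal_closure Rel.

(** * p-deficiency *)

Definition is_pvaluation (p : nat) (G : groupType) (w : G) (k : nat) : Prop :=
  (exists v, w = v ^+ (p ^ k)) /\
  (forall j, (exists v, w = v ^+ (p ^ j)) -> (j <= k)%N).

(* The default value 0 is never used for w != 1 in a free group and p prime, as
   w then has only finitely many roots. *)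
Definition pvaluation (p : nat) (G : groupType) (w : G) : nat :=
  xget 0%N [set k | is_pvaluation p w k].

Local Open Scope ring_scope.

(* p^{-nu_p(w)}, with nu_p(1) = +oo, so that a trivial relator has weight 0. *)
Definition pweight (R : realType) (p : nat) (G : groupType) (w : G) : R :=
  if w == 1%g then 0 else p%:R ^- pvaluation p w.

Definition pres_pdeficiency (R : realType) (p : nat) (X : finType)
    (Rel : set (free_group X)) : \bar R :=
  ((#|X|%:R - 1)%:E - \esum_(w in Rel) (pweight R p w)%:E)%E.

Definition pdeficiency (R : realType) (p : nat) (Gamma : groupType) : \bar R :=
  ereal_sup [set d | exists (X : finType) (Rel : set (free_group X)),
    is_presentation Gamma Rel /\ d = pres_pdeficiency R p Rel].

(* Main.v *)
(* Upper bound.  Put Q = p ^ N with N large, let A = F_p[x]/(x^Q) and T = 1 + x,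
   so that T^Q = 1.  Send the generator of C_{e_i}, with q_i = p ^ nu_p(e_i), to
   T^(Q/q_i) and F_r to 1; every presentation <X|R> of the free product then has a
   Fox derivative d : F(X) -> A^X.  If r = v^q with q = p^k then
   d r = (1 + u + ... + u^(q-1)) d v, where u is the image of v; as u^q = 1, this
   sum is a multiple of x^(Q - Q/q), and vanishes if q > Q, so the submodule A (d r)
   has dimension at most Q/q over F_p.  Modulo these submodules A^X is generated by
   the derivatives of the generators of the factors, and the one coming from C_{e_i}
   is killed by x^(Q - Q/q_i).  Counting elements gives
     Q |X| <= sum_(r in R) Q p^(-nu_p(r)) + sum_i (Q - Q/q_i) + r Q.
   Lower bound.  The standard presentation attains the value: reducing the exponent
   of the i-th generator modulo p^(nu_p(e_i) + 1) shows nu_p(x_i^e_i) = nu_p(e_i). *)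
Require Import Defs.
From HB Require Import structures.
From mathcomp Require Import all_boot all_order all_algebra perm.
From mathcomp Require Import boolp classical_sets reals constructive_ereal.
From mathcomp Require Import cardinality fsbigop ereal esum.
From mathcomp Require Import lra.
Import Order.TTheory GRing.Theory Num.Theory.
Local Open Scope ring_scope.

Set Implicit Arguments.
Unset Strict Implicit.
Unset Printing Implicit Defensive.

(** * Words, free groups and free products *)

Section WordMorphisms.
Local Open Scope group_scope.

Section Multiplicative.
Variables (G H : groupType) (f : {multiplicative G -> H}).

(* The library's gmulf1, gmulfV and gmulfXn do not apply to a morphism declared
   only as multiplicative, even between groups. *)
Lemma multiplicative1 : f 1 = 1.
Proof. by apply: (mulgI (f 1)); rewrite -gmulfM !mulg1. Qed.

Lemma multiplicativeV x : f x^-1 = (f x)^-1.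
Proof. by apply: (mulgI (f x)); rewrite -gmulfM !mulgV multiplicative1. Qed.

Lemma multiplicativeX x n : f (x ^+ n) = f x ^+ n.
Proof.
by elim: n => [|n IHn]; rewrite ?multiplicative1 // !expgS gmulfM IHn.
Qed.

End Multiplicative.

Lemma word_class_nil (W : wordSystem) : word_class (W := W) [::] = 1.
Proof. by []. Qed.

Lemma word_class_cat (W : wordSystem) (u v : seq (letter W)) :
  word_class (u ++ v) = word_class u * word_class v.
Proof. by rewrite -word_mulE. Qed.

Lemma word_ind (W : wordSystem) (P : word_group W -> Prop) :
  P 1 -> (forall a u, P (word_class [:: a]) -> P u -> P (word_class [:: a] * u)) ->
  (forall a, P (word_class [:: a])) -> forall u, P u.
Proof.
move=> P1 PM Pgen u; rewrite -(word_class_repr u).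
elim: (repr u) => [|a s IHs]; first exact: P1.
by rewrite -cat1s -word_mulE; apply: PM.
Qed.

(** The product of the letter values is constant on congruence classes once it respects the rules,
    so it may be computed on the chosen representative [repr x]. *)
Lemma word_hom (W : wordSystem) (H : groupType) (g : letter W -> H) :
  (forall u v, word_rule u v -> \prod_(a <- u) g a = \prod_(a <- v) g a) ->
  exists h : {multiplicative word_group W -> H},
    forall a, h (word_class [:: a]) = g a.
Proof.
move=> gP; pose h (x : word_group W) := \prod_(a <- repr x) g a.
have gE u v : word_congr (@word_rule W) u v ->
    \prod_(a <- u) g a = \prod_(a <- v) g a.
  elim=> {u v} [u v /gP //||u v _ ->//|u v w _ -> _ ->//|] //.
  by move=> u u' v v' _ IHu _ IHv; rewrite !big_cat /= IHu IHv.
have hE u : h (word_class u) = \prod_(a <- u) g a.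
  by apply/gE/word_classP; rewrite word_class_repr.
have hM : {morph h : x y / x * y}.
  by move=> x y; rewrite hE big_cat.
pose hhom := isMultiplicative.Build _ _ h hM.
pose hh : {multiplicative word_group W -> H} := HB.pack h hhom.
by exists hh => a; rewrite /= hE big_seq1.
Qed.

Lemma free_hom (X : choiceType) (H : groupType) (g : X -> H) :
  exists h : {multiplicative free_group X -> H}, forall x, h (free_gen x) = g x.
Proof.
pose g' (a : X * bool) := if a.2 then g a.1 else (g a.1)^-1.
have [|h hE] := @word_hom (free_system X) H g'; last first.
  by exists h => x; rewrite hE.
move=> _ _ [[x b]]; rewrite big_cons big_seq1 big_nil /g' /=.
by case: b; rewrite ?mulgV ?mulVg.
Qed.

Lemma free_inv_gen {X : choiceType} (x : X) :
  word_class (W := free_system X) [:: (x, false)] = (free_gen x)^-1.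
Proof.
apply: (mulgI (free_gen x)); rewrite mulgV.
rewrite [LHS]word_mulE; apply/word_classP/WCRule.
exact: (FreeCancel (x, true)).
Qed.

Lemma free_ind (X : choiceType) (P : free_group X -> Prop) :
  P 1 -> (forall u v, P u -> P v -> P (u * v)) -> (forall u, P u -> P u^-1) ->
  (forall x, P (free_gen x)) -> forall u, P u.
Proof.
move=> P1 PM PV Pgen.
have Pl a : P (word_class (W := free_system X) [:: a]).
  by case: a => x []; rewrite ?free_inv_gen; [|apply: PV]; apply: Pgen.
by apply: word_ind => // a u; apply: PM.
Qed.

Section FreeProd.
Variables (I : choiceType) (G : I -> groupType).

Lemma free_prod_inM i : {morph @free_prod_in I G i : x y / x * y}.
Proof.
move=> x y; rewrite [RHS]word_mulE; apply/word_classP/WCSym/WCRule.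
exact: FreeProdMul.
Qed.

HB.instance Definition _ i :=
  isMultiplicative.Build (G i) (free_prod G) (@free_prod_in I G i)
    (@free_prod_inM i).

Lemma free_prod_hom (H : groupType) (g : forall i, {multiplicative G i -> H}) :
  exists h : {multiplicative free_prod G -> H},
    forall i x, h (free_prod_in x) = g i x.
Proof.
pose g' (a : {i : I & G i}) := g (tag a) (tagged a).
have [|h hE] := @word_hom (free_prod_system G) H g'; last first.
  by exists h => i x; rewrite hE.
move=> _ _ [i|i x y]; rewrite !big_cons !big_nil /g' /= !mulg1.
  exact: multiplicative1.
by rewrite gmulfM.
Qed.

Lemma free_prod_ind (P : free_prod G -> Prop) :
  P 1 -> (forall u v, P u -> P v -> P (u * v)) ->
  (forall i (x : G i), P (free_prod_in x)) -> forall u, P u.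
Proof.
move=> P1 PM Pgen.
have Pl a : P (word_class (W := free_prod_system G) [:: a]).
  by case: a => i x; apply: Pgen.
by apply: word_ind => // a u; apply: PM.
Qed.

End FreeProd.

End WordMorphisms.

(** * Fox derivatives *)

Section FoxDerivative.
Variables (X : finType) (A : finComNzRingType) (chi : free_group X -> A).
Hypotheses (chi1 : chi 1%g = 1) (chiM : forall v w, chi (v * w)%g = chi v * chi w).

(* w acts on A^X by the affine permutation m |-> chi w *: m + d w. *)
Lemma fox_derivative_exists :
  exists d : free_group X -> 'rV[A]_#|X|,
    (forall v w, d (v * w)%g = chi w *: d v + d w) /\
    (forall x, d (free_gen x) = delta_mx 0 (enum_rank x)).
Proof.
have chiV w : chi w * chi w^-1%g = 1 by rewrite -chiM mulgV.
(* The value [chi (free_gen x)] is a unit, so [aff x] is injective, hence a permutation of the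
   finite set A^X. Freeness turns these permutations into an action, and the derivative of [w] is
   the translation part, read off at 0. *)
pose aff x (m : 'rV[A]_#|X|) :=
  chi (free_gen x) *: m + delta_mx 0 (enum_rank x).
have affI x : injective (aff x).
  move=> m m' /addIr /(congr1 (fun u => chi (free_gen x)^-1%g *: u)).
  by rewrite !scalerA mulrC chiV !scale1r.
have [h hE] := free_hom (fun x => perm (@affI x)).
exists (fun w => h w 0).
have haff w : forall m, h w m = chi w *: m + h w 0.
  elim/free_ind: w => [m|u v IHu IHv m|u IHu m|x m].
  - by rewrite multiplicative1 !perm1 chi1 scale1r addr0.
  - rewrite gmulfM !permM IHv [h v (h u 0)]IHv IHu chiM mulrC.
    by rewrite scalerDr scalerA addrA.
  - have hK n : h u (h u^-1%g n) = n by rewrite -permM -gmulfM mulVg multiplicative1 perm1.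
    have hV n : h u^-1%g n = chi u^-1%g *: (n - h u 0).
      have := hK n; rewrite IHu => /(canRL (addrK _)) <-.
      by rewrite scalerA mulrC chiV scale1r.
    by rewrite [LHS]hV [h u^-1%g 0]hV sub0r scalerBr scalerN.
  - by rewrite hE !permE /aff scaler0 add0r.
split=> [v w|x]; first by rewrite gmulfM permM haff.
by rewrite hE permE /aff scaler0 add0r.
Qed.

End FoxDerivative.

Section FoxCalculus.
Variables (X : finType) (A : comNzRingType) (n : nat).
Variables (chi : free_group X -> A) (d : free_group X -> 'rV[A]_n).
Hypotheses (chi1 : chi 1%g = 1) (chiM : forall v w, chi (v * w)%g = chi v * chi w).
Hypothesis dM : forall v w, d (v * w)%g = chi w *: d v + d w.

Lemma fox1 : d 1%g = 0.
Proof.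
by have := dM 1%g 1%g; rewrite mulg1 chi1 scale1r -{1}[d 1%g]addr0 => /addrI.
Qed.

Lemma foxX w k : d (w ^+ k)%g = (\sum_(i < k) chi w ^+ i) *: d w.
Proof.
elim: k => [|k IHk]; first by rewrite expg0 fox1 big_ord0 scale0r.
rewrite expgSr dM IHk big_ord_recl scalerDl expr0 scale1r addrC; congr (_ + _).
rewrite scalerA mulr_sumr; congr (_ *: _).
by apply: eq_bigr => i _; rewrite exprS.
Qed.

Lemma foxV w : d w^-1%g = - chi w^-1%g *: d w.
Proof.
by apply/eqP; rewrite scaleNr -addr_eq0 addrC -dM mulgV fox1.
Qed.

(** Because of this scaling, the elements of the kernel of [chi] whose derivative lies in a given
    submodule are stable under conjugation. *)
Lemma foxJ w v : chi w = 1 -> d (w ^ v)%g = chi v *: d w.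
Proof.
have chiV : chi v^-1%g * chi v = 1 by rewrite -chiM mulVg chi1.
move=> w1; rewrite conjgE !dM chiM w1 mul1r foxV scalerA mulrC mulNr chiV.
by rewrite scaleN1r addrCA addNr addr0.
Qed.

End FoxCalculus.

(** * Truncated polynomials in characteristic p *)

Lemma expr1D_pchar (A : comNzRingType) (p : nat) (y : A) k :
  p \in [pchar A] -> (1 + y) ^+ (p ^ k) = 1 + y ^+ (p ^ k).
Proof.
move=> pA; rewrite exprDn_pchar ?expr1n // (eq_pnat _ (pcharf_eq pA)).
by rewrite pnatX pnat_id ?(pcharf_prime pA).
Qed.

(** In A[X] the factor X can be cancelled from (1 + X)^(p^k) - 1 = X^(p^k). Evaluating afterwards
    covers a [y] that is a zero divisor. *)
Lemma geometric_sum_pchar (A : comNzRingType) (p : nat) (y : A) k :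
  p \in [pchar A] -> \sum_(i < p ^ k) (1 + y) ^+ i = y ^+ (p ^ k).-1.
Proof.
move=> pA; have p_pr := pcharf_prime pA.
have pAX : p \in [pchar {poly A}] by rewrite pchar_poly.
have : 'X * (\sum_(i < p ^ k) (1 + 'X) ^+ i) = 'X * 'X ^+ (p ^ k).-1 :> {poly A}.
  rewrite -exprS prednK ?expn_gt0 ?prime_gt0 //.
  have := subrX1 (1 + 'X : {poly A}) (p ^ k).
  by rewrite expr1D_pchar // addrAC subrr add0r addrAC subrr add0r => ->.
move=> /(monic_lreg (monicX A)) /(congr1 (horner_eval y)).
rewrite rmorphXn rmorph_sum /= /horner_eval hornerX => <-.
by apply: eq_bigr => i _; rewrite horner_exp !hornerE.
Qed.

Section TruncatedPolynomials.
Variables (p N : nat) (A : finComNzRingType) (ev : {rmorphism {poly 'F_p} -> A}).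
Hypotheses (p_pr : prime p) (evXQ : ev 'X ^+ (p ^ N) = 0).
Local Notation x := (ev 'X).

Lemma trunc_pchar : p \in [pchar A].
Proof.
apply/andP; split=> //=; apply/eqP.
by rewrite -(rmorph_nat ev) -polyC_natr pchar_Fp_0 // polyC0 rmorph0.
Qed.

Lemma trunc_expQ : (1 + x) ^+ (p ^ N) = 1.
Proof.
by rewrite expr1D_pchar ?trunc_pchar // evXQ addr0.
Qed.

(** The hypothesis gives p^(N-k) | a, so by Frobenius (1 + x)^a is a power of 1 + y with y =
    x^(p^(N-k)). It is thus 1 + y z for some z, and its geometric sum is (y z)^(p^k - 1). *)
Lemma trunc_geometric_sum a k : (p ^ N %| a * p ^ k)%N ->
  exists z, \sum_(i < p ^ k) ((1 + x) ^+ a) ^+ i =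
    z * x ^+ (p ^ (N - k) * (p ^ k).-1).
Proof.
move=> Qdvd; have ca : (p ^ (N - k) %| a)%N.
  (* For k > N the truncated difference N - k is 0, and the divisor is 1. *)
  have [kN|Nk] := leqP k N; last by rewrite (eqP (ltnW Nk)) dvd1n.
  by rewrite -(@dvdn_pmul2r (p ^ k)%N) ?expn_gt0 ?prime_gt0 // -expnD subnK.
have [b ->] := dvdnP ca; rewrite mulnC exprM.
rewrite expr1D_pchar ?trunc_pchar //.
set y := x ^+ (p ^ (N - k)); exists ((\sum_(i < b) (1 + y) ^+ i) ^+ (p ^ k).-1).
have -> : (1 + y) ^+ b = 1 + y * \sum_(i < b) (1 + y) ^+ i.
  have := subrX1 (1 + y) b; rewrite [1 + y - 1]addrAC subrr add0r.
  by move/(canRL (subrK _)) => ->; rewrite addrC.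
by rewrite geometric_sum_pchar ?trunc_pchar // exprMn mulrC /y exprM.
Qed.

Hypothesis ev_surj : forall a, exists g, a = ev g.

(** Since x^c kills x^(Q-c) m, where Q = p^N, a scalar acts only through the c lowest coefficients
    of a polynomial representing it. *)
Lemma trunc_card_scale (V : finLmodType A) (m : V) c : (c <= p ^ N)%N ->
  (#|[set a *: (x ^+ (p ^ N - c) *: m) | a : A]%SET| <= p ^ c)%N.
Proof.
move=> cQ.
have -> : (p ^ c = #|[set: {poly_c 'F_p}]%SET|)%N.
  by rewrite cardsT card_npoly card_Fp.
set y := _ *: m.
apply: leq_trans (leq_imset_card (fun g : {poly_c 'F_p} => ev g *: y) _).
apply/subset_leq_card/fintype.subsetP => _ /imsetP[a _ ->]; have [g ->] := ev_surj a.
apply/imsetP; exists (npolyp c (take_poly c g)); rewrite ?inE //.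
rewrite npolypK ?size_take_poly // -{1}(poly_take_drop c g).
rewrite rmorphD rmorphM rmorphXn scalerDl [X in _ + X](_ : _ = 0) ?addr0 //.
by rewrite /y scalerA -mulrA -exprD subnKC // evXQ mulr0 scale0r.
Qed.

End TruncatedPolynomials.

(** * Counting the elements of a finite module by generators *)

Lemma card_sum_sets (K : finType) (U : finZmodType) (S : K -> {set U}) :
  (forall v, exists2 a : K -> U, (forall k, a k \in S k) & v = \sum_k a k) ->
  (#|U| <= \prod_k #|S k|)%N.
Proof.
move=> Usum; have <- : #|family S| = (\prod_k #|S k|)%N.
  by rewrite card_family foldrE big_image.
rewrite -cardsT.
apply: leq_trans (leq_imset_card (fun a : {ffun K -> U} => \sum_k a k) _).
apply/subset_leq_card/fintype.subsetP => v _; have [a aS ->] := Usum v.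
apply/imsetP; exists (finfun a); last by apply: eq_bigr => k _; rewrite ffunE.
by apply/familyP => k; rewrite ffunE.
Qed.

Section Span.
Variables (A : comNzRingType) (U : lmodType A) (K : finType) (u : K -> U).

Definition in_span (v : U) : Prop := exists c : K -> A, v = \sum_k c k *: u k.

Lemma in_span0 : in_span 0.
Proof. by exists (fun=> 0); rewrite big1 // => k _; rewrite scale0r. Qed.

Lemma in_spanD v w : in_span v -> in_span w -> in_span (v + w).
Proof.
move=> [b ->] [c ->]; exists (fun k => b k + c k).
by rewrite -big_split; apply: eq_bigr => k _; rewrite scalerDl.
Qed.

Lemma in_spanZ a v : in_span v -> in_span (a *: v).
Proof.
move=> [c ->]; exists (fun k => a * c k).
by rewrite scaler_sumr; apply: eq_bigr => k _; rewrite scalerA.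
Qed.

Lemma in_span_sum (I : finType) (F : I -> U) :
  (forall i, in_span (F i)) -> in_span (\sum_i F i).
Proof. by move=> FP; elim/big_ind: _ => //; [apply: in_span0|apply: in_spanD]. Qed.

Lemma in_span_gen k : in_span (u k).
Proof.
exists (fun l => (l == k)%:R); rewrite (bigD1 k) //= eqxx scale1r big1 ?addr0 //.
by move=> l /negPf ->; rewrite scale0r.
Qed.

End Span.

Section CountGenerators.
Variables (p : nat) (A : finComNzRingType) (ev : {rmorphism {poly 'F_p} -> A}).
Hypothesis p_pr : prime p.
Hypothesis ev_surj : forall a, exists g, a = ev g.
Variables (U : finLmodType A) (K J : finType) (m : K -> U) (u : J -> U).

(** Modulo the span of [m], the coefficient of [u j] matters only modulo X^(b j), so it may be
    represented by a polynomial of size at most [b j]; there are p^(b j) of these. *)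
Lemma card_gen_torsion (b : J -> nat) :
  (forall j, in_span m (ev 'X ^+ b j *: u j)) ->
  (forall v, exists c : J -> A, in_span m (v - \sum_j c j *: u j)) ->
  (#|U| <= (\prod_k #|[set a *: m k | a : A]%SET|) * \prod_j p ^ b j)%N.
Proof.
move=> utors Ugen.
pose S (k : K + J) := match k with
  | inl k => [set a *: m k | a : A]%SET
  | inr j => [set ev g *: u j | g : {poly_(b j) 'F_p}]%SET end.
suff Usum v : exists2 a : K + J -> U, (forall k, a k \in S k) & v = \sum_k a k.
  apply: leq_trans (card_sum_sets Usum) _.
  rewrite big_sumType leq_mul2l; apply/orP; right; apply: leq_prod => j _.
  apply: leq_trans (leq_imset_card _ _) _.
  by rewrite card_npoly card_Fp.
have [c vP] := Ugen v.
have cg j : exists g : {poly_(b j) 'F_p}, in_span m ((c j - ev g) *: u j).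
  have [g ->] := ev_surj (c j); exists (npolyp _ (take_poly (b j) g)).
  rewrite npolypK ?size_take_poly // -{1}(poly_take_drop (b j) g) addrC rmorphD.
  by rewrite addKr rmorphM rmorphXn -scalerA; apply: in_spanZ.
pose g j := projT1 (cid (cg j)); have gP j := projT2 (cid (cg j)).
rewrite -/(g _) in gP.
have [e eE] : in_span m (v - \sum_j ev (g j) *: u j).
  rewrite -[v](subrK (\sum_j c j *: u j)) -addrA -sumrB.
  apply: in_spanD => //; apply: in_span_sum => j.
  by rewrite -scalerBl.
exists (fun k => match k with inl k => e k *: m k | inr j => ev (g j) *: u j end).
  by case=> k; apply: imset_f.
by rewrite big_sumType /= -eE subrK.
Qed.

End CountGenerators.

(** * The upper bound *)

(* This also holds for the junk value 0. *)
Lemma pvaluation_root (p : nat) (G : groupType) (w : G) :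
  exists v, w = (v ^+ (p ^ pvaluation p w))%g.
Proof.
rewrite /pvaluation; case: xgetP => [k _ [] //|_].
by exists w; rewrite expn0 expg1.
Qed.

Lemma pweight_ge0 (R : realType) (p : nat) (G : groupType) (w : G) :
  0 <= pweight R p w.
Proof. by rewrite /pweight; case: ifP => // _; rewrite invr_ge0 exprn_ge0. Qed.

Lemma kernel_normal (G H : groupType) (f : {multiplicative G -> H}) :
  normal_subgroup (fun x => f x = 1%g).
Proof.
split=> [|x y /= x1 y1|x /= x1|x y /= x1]; first exact: multiplicative1.
- by rewrite gmulfM x1 y1 mulg1.
- by rewrite multiplicativeV x1 invg1.
- by rewrite conjgE !gmulfM multiplicativeV x1 mul1g mulVg.
Qed.

Lemma normal_closure_sub (G : groupType) (Y N : set G) :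
  normal_subgroup N -> (forall y, Y y -> N y) -> forall x, normal_closure Y x -> N x.
Proof. by move=> Nn YN x; apply. Qed.

Section DeficiencyBound.
Variables (p N : nat) (A : finComNzRingType) (ev : {rmorphism {poly 'F_p} -> A}).
Hypotheses (p_pr : prime p) (evXQ : ev 'X ^+ (p ^ N) = 0).
Hypothesis ev_surj : forall a, exists g, a = ev g.
Hypothesis cardA : #|A| = (p ^ (p ^ N))%N.

Variables (X : finType) (Rel : set (free_group X)) (Gamma : groupType).
Variable f : {multiplicative free_group X -> Gamma}.
Hypotheses (f_surj : forall g, exists w, f w = g).
Hypothesis f_ker : forall w, f w = 1%g <-> normal_closure Rel w.

Variable a : Gamma -> nat.
Local Notation chi w := ((1 + ev 'X) ^+ a (f w)).
Hypotheses (a1 : (p ^ N %| a 1%g)%N).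
Hypothesis aM : forall g h, a (g * h)%g = a g + a h %[mod p ^ N].

(** The [gam j] generate [Gamma]. The exponent [t j] may be 0, which allows generators of infinite
    order. The geometric sum in [gam_dvd] is the factor by which the derivative of a lift of [gam j]
    is multiplied when the lift is raised to the power [t j]. *)
Variables (J : finType) (gam : J -> Gamma) (b : J -> nat) (t : J -> nat).
Hypothesis gam_ind : forall P : Gamma -> Prop, P 1%g ->
  (forall g h, P g -> P h -> P (g * h)%g) -> (forall g, P g -> P g^-1)%g ->
  (forall j, P (gam j)) -> forall g, P g.
Hypothesis gam_tors : forall j, (gam j ^+ t j = 1)%g.
Hypothesis gam_dvd : forall j, exists z,
  ev 'X ^+ b j = z * \sum_(i < t j) ((1 + ev 'X) ^+ a (gam j)) ^+ i.

Let expT_mod k l : k = l %[mod p ^ N] -> (1 + ev 'X) ^+ k = (1 + ev 'X) ^+ l.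
Proof.
have expTQ := trunc_expQ p_pr evXQ.
move=> kl; rewrite (divn_eq k (p ^ N)) (divn_eq l (p ^ N)) kl.
by rewrite !exprD ![(_ * p ^ N)%N]mulnC !exprM expTQ !expr1n.
Qed.

Let chi1 : chi 1%g = 1.
Proof.
by rewrite multiplicative1 -[RHS](expr0 (1 + ev 'X)); apply/expT_mod/eqP; rewrite mod0n.
Qed.

Let chiM v w : chi (v * w)%g = chi v * chi w.
Proof. by rewrite gmulfM -exprD; apply/expT_mod. Qed.

Let aX_dvd g n : (g ^+ n = 1)%g -> (p ^ N %| a g * n)%N.
Proof.
have aX l : a (g ^+ l)%g = (a g * l)%N %[mod p ^ N].
  elim: l => [|l IHl]; first by rewrite expg0 muln0 mod0n; apply/eqP.
  by rewrite expgS aM -modnDmr IHl modnDmr mulnS.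
by move=> gn; rewrite /dvdn -aX gn; apply: a1.
Qed.

(* Rel may be infinite, but its derivatives take finitely many values; s picks one
   relator for each of them. *)
Lemma deficiency_bound (R : realType) :
  exists2 s : seq (free_group X), uniq s /\ (forall w, w \in s -> Rel w) &
  ((p ^ N) * #|X|)%:R <=
    (p ^ N)%:R * \sum_(w <- s) pweight R p w + (\sum_j b j)%:R.
Proof.
have [d [dM dgen]] := fox_derivative_exists chi1 chiM.
pose D := [set m | `[< exists2 w, Rel w & d w = m >]]%SET.
(* Indexing by the whole finite module gives a finite family; indices outside [D] contribute only
   0. *)
pose fam m := if m \in D then m else 0.
have Rel_chi w : Rel w -> chi w = 1.
  move=> Rw; have -> : f w = 1%g by apply/f_ker => M [_]; apply.
  by rewrite -(multiplicative1 f).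
have ker_span w : f w = 1%g -> in_span fam (d w).
  (* [M] is a normal subgroup containing the relators, hence their normal closure. Triviality of
     [chi] is carried along because [foxJ] needs it. *)
  move=> /f_ker; pose M := fun w => chi w = 1 /\ in_span fam (d w).
  suff wM : normal_closure Rel w -> M w by move=> /wM[].
  apply: normal_closure_sub => [|{}w Rw]; last first.
    split; first exact: Rel_chi.
    have wD : d w \in D by rewrite inE; apply/asboolP; exists w.
    by have <- : fam (d w) = d w; [rewrite /fam wD | apply: in_span_gen].
  split=> [|v {}w [v1 vS] [w1 wS]|v [v1 vS]|v {}w [v1 vS]].
  - by split; rewrite ?(fox1 chi1 dM) //; apply: in_span0.
  - split; first by rewrite chiM v1 w1 mulr1.
    by rewrite dM; apply: in_spanD => //; apply: in_spanZ.
  - split; first by have := chiM v v^-1%g; rewrite mulgV chi1 v1 mul1r.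
    by rewrite (foxV chi1 dM); apply: in_spanZ.
  - split; last by rewrite (foxJ chi1 chiM dM) //; apply: in_spanZ.
    by rewrite conjgE !chiM v1 mul1r -chiM mulVg.
have [w_ wE] := choice (fun j => f_surj (gam j)).
(* [L] is the submodule generated by the derivatives of the relators and of the lifts [w_ j]; it
   will turn out to be everything. *)
pose L v := exists c : J -> A, in_span fam (v - \sum_j c j *: d (w_ j)).
have LD v w : L v -> L w -> L (v + w).
  move=> [c1 c1P] [c2 c2P]; exists (fun j => c1 j + c2 j).
  under eq_bigr do rewrite scalerDl.
  by rewrite big_split opprD addrACA; apply: in_spanD.
have LZ c v : L v -> L (c *: v).
  move=> [c1 c1P]; exists (fun j => c * c1 j).
  under eq_bigr do rewrite -scalerA.
  by rewrite -scaler_sumr -scalerBr; apply: in_spanZ.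
have Lspan v : in_span fam v -> L v.
  move=> vS; exists (fun=> 0); rewrite big1 ?subr0 // => j _.
  by rewrite scale0r.
have Lw_ j : L (d (w_ j)).
  exists (fun k => (k == j)%:R); rewrite (bigD1 j) //= eqxx scale1r big1 => [|k].
    by rewrite addr0 subrr; apply: in_span0.
  by move=> /negPf ->; rewrite scale0r.
have Ld w : L (d w).
  (* Induction over [Gamma] only reaches some [v] with the same image as [w]. The quotient of [w] by
     [v] lies in the kernel of [f], where [ker_span] applies. *)
  have [v vw Lv] : exists2 v, f v = f w & L (d v).
    move: (f w); apply: gam_ind => [|g h [v <- Lv] [u <- Lu]|g [v <- Lv]|j].
    - exists 1%g; rewrite ?multiplicative1 // (fox1 chi1 dM).
      exact/Lspan/in_span0.
    - by exists (v * u)%g; rewrite ?gmulfM // dM; apply: LD => //; apply: LZ.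
    - by exists v^-1%g; rewrite ?multiplicativeV // (foxV chi1 dM); apply: LZ.
    - by exists (w_ j).
  rewrite -[w](mulgVK v) dM; apply: LD => //; apply: LZ.
  by apply/Lspan/ker_span; rewrite gmulfM multiplicativeV vw mulgV.
have Lall v : L v.
  rewrite (row_sum_delta v); elim/big_ind: _ => // [|i _].
    exact/Lspan/in_span0.
  by rewrite -(enum_valK i) -dgen; apply: LZ.
(* By [gam_dvd] this is a multiple of the derivative of [w_ j ^+ t j], which lies in the kernel of
   [f]. *)
have tors j : in_span fam (ev 'X ^+ b j *: d (w_ j)).
  have [z ->] := gam_dvd j; rewrite -scalerA; apply: in_spanZ.
  rewrite -wE -(foxX chi1 dM); apply: ker_span.
  by rewrite multiplicativeX wE gam_tors.
have bnd := card_gen_torsion p_pr ev_surj tors Lall.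
have relEx m : exists w, m \in D -> Rel w /\ d w = m.
  case: (boolP (m \in D)) => [|_]; last by exists 1%g.
  by rewrite inE => /asboolP[w Rw dw]; exists w.
have [rel relP] := choice relEx.
have card_fam m : exists2 e, (#|[set c *: fam m | c : A]%SET| <= p ^ e)%N &
    e%:R <= (p ^ N)%:R * (if m \in D then pweight R p (rel m) else 0).
  (* The exponent 0 suffices here; this covers the indices outside [D] and the trivial relator of
     weight 0. *)
  have [m0|m_neq0] := eqVneq (fam m) 0.
    exists 0%N; last by rewrite mulr_ge0 ?ler0n //; case: ifP => // _; apply: pweight_ge0.
    rewrite m0 expn0; apply: (@leq_trans #|[set (0 : 'rV[A]_#|X|)]%SET|).
      apply/subset_leq_card/fintype.subsetP => _ /imsetP[c _ ->].
      by rewrite scaler0 inE.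
    by rewrite cards1.
  have mD : m \in D by move: m_neq0; rewrite /fam; case: ifP; rewrite ?eqxx.
  have [Rm dm] := relP m mD; have [v vE] := pvaluation_root p (rel m).
  move: m_neq0; rewrite mD /fam mD; set k := pvaluation p (rel m) in vE *.
  have [u uE] : exists u, m = ev 'X ^+ (p ^ (N - k) * (p ^ k).-1) *: u.
    have [|z zE] := trunc_geometric_sum (N := N) ev p_pr (a := a (f v)) (k := k).
      by apply: aX_dvd; rewrite -multiplicativeX -vE; apply/f_ker => M [_]; apply.
    by exists (z *: d v); rewrite -dm vE (foxX chi1 dM) zE scalerA mulrC.
  (* If k > N then p^k - 1 >= p^N, so the power of x in [uE] vanishes, contradicting that [m] is
     nonzero. *)
  have [kN|Nk] := leqP k N; last first.
    have : (p ^ N <= (p ^ k).-1)%N.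
      by rewrite -ltnS prednK ?expn_gt0 ?prime_gt0 // ltn_exp2l ?prime_gt1.
    rewrite uE (eqP (ltnW Nk)) mul1n => /subnKC <-.
    by rewrite exprD evXQ mul0r scale0r eqxx.
  have cE : (p ^ (N - k) * (p ^ k).-1 = p ^ N - p ^ (N - k))%N.
    by rewrite -subn1 mulnBr muln1 -expnD subnK.
  move=> m_neq0; exists (p ^ (N - k))%N.
    rewrite uE cE; apply: trunc_card_scale => //.
    by rewrite leq_exp2l ?prime_gt1 // leq_subr.
  have relm_neq1 : rel m != 1%g.
    by apply: contraNneq m_neq0 => rm1; rewrite -dm rm1 (fox1 chi1 dM).
  rewrite /pweight (negPf relm_neq1) -/k !natrX.
  by rewrite -{2}(subnK kN) exprD mulfK // expf_neq0 // pnatr_eq0 -lt0n prime_gt0.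
have ex_e m : exists e, (#|[set c *: fam m | c : A]%SET| <= p ^ e)%N /\
    e%:R <= (p ^ N)%:R * (if m \in D then pweight R p (rel m) else 0).
  by have [e ? ?] := card_fam m; exists e.
have [e eP] := choice ex_e.
exists [seq rel m | m <- enum D].
  split=> [|w /mapP[m]]; last by rewrite mem_enum => /relP[Rm _] ->.
  rewrite map_inj_in_uniq ?enum_uniq // => m1 m2; rewrite !mem_enum.
  by move=> /relP[_ dm1] /relP[_ dm2] rel12; rewrite -dm1 rel12.
(* This compares exponents of p in [bnd], as A^X has p^(p^N |X|) elements. *)
have: (p ^ N * #|X| <= \sum_m e m + \sum_j b j)%N.
  rewrite -(leq_exp2l _ _ (prime_gt1 p_pr)) expnM -cardA expnD.
  rewrite card_mx mul1n in bnd; apply: leq_trans bnd _.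
  rewrite !expn_sum leq_mul2r; apply/orP; right; apply: leq_prod => m _.
  by have [] := eP m.
rewrite -(ler_nat R) => /le_trans; apply; rewrite natrD lerD2r.
rewrite natr_sum big_map big_enum [X in _ * X]big_mkcond mulr_sumr; apply: ler_sum => m _.
by have [] := eP m.
Qed.

End DeficiencyBound.

(** * Generators and universal property of the free product of cyclic groups and a free group *)

Section CyclicFreeProduct.
Variables (s r : nat) (e : 'I_s -> nat).
Local Notation Gamma := (cyclic_free_prod r e).
Local Notation factor := (fun j : option 'I_s =>
  if j is Some i then cyclic_group (e i) else free_group 'I_r).

Definition cyclic_gen (n : nat) : cyclic_group n := inZp 1.

Lemma cyclic_genX n k : (cyclic_gen n ^+ k)%g = inZp k.
Proof. by rewrite Zp_expg; apply/val_inj; rewrite /= modnMml mul1n. Qed.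

Lemma cyclic_hom (n : nat) (H : groupType) (h : H) : (0 < n)%N -> (h ^+ n = 1)%g ->
  exists f : {multiplicative cyclic_group n -> H}, forall x, f x = (h ^+ (x : nat))%g.
Proof.
move=> n_gt0 hn; pose f (x : cyclic_group n) : H := (h ^+ (x : nat))%g.
have fM : {morph f : x y / (x * y)%g}.
  move=> x y; rewrite /f.
  have -> : nat_of_ord (x * y)%g = ((x + y) %% n)%N.
    rewrite /=; congr modn; exact: prednK.
  rewrite -expgnDr [in RHS](divn_eq (x + y) n) expgnDr mulnC expgnA hn expg1n.
  by rewrite mul1g.
pose fhom := isMultiplicative.Build _ _ f fM.
pose ff : {multiplicative cyclic_group n -> H} := HB.pack f fhom.
by exists ff.
Qed.

Definition cfp_gen (j : 'I_s + 'I_r) : Gamma :=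
  match j with
  | inl i => free_prod_in (G := factor) (i := Some i) (cyclic_gen (e i))
  | inr j => free_prod_in (G := factor) (i := None) (free_gen j)
  end.

Lemma cfp_ind (P : Gamma -> Prop) : P 1%g ->
  (forall g h, P g -> P h -> P (g * h)%g) -> (forall g, P g -> P g^-1)%g ->
  (forall j, P (cfp_gen j)) -> forall g, P g.
Proof.
move=> P1 PM PV Pgen; apply: free_prod_ind => // -[i|] x.
  have -> : x = (cyclic_gen (e i) ^+ (x : nat))%g.
    by rewrite cyclic_genX valZpK.
  rewrite (multiplicativeX (free_prod_in (i := Some i))).
  elim: (x : nat) => [|k IHk]; first by rewrite expg0.
  by rewrite expgS; apply: PM => //; apply: (Pgen (inl i)).
elim/free_ind: x => [|u v Pu Pv|u Pu|j].
- by rewrite (multiplicative1 (free_prod_in (i := None))).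
- by rewrite (gmulfM (s := free_prod_in (i := None))); apply: PM.
- by rewrite (multiplicativeV (free_prod_in (i := None))); apply: PV.
- exact: (Pgen (inr j)).
Qed.

Hypothesis e_gt0 : forall i, (0 < e i)%N.

Lemma cfp_hom (H : groupType) (h : 'I_s + 'I_r -> H) :
  (forall i, h (inl i) ^+ e i = 1)%g ->
  exists f : {multiplicative Gamma -> H}, forall j, f (cfp_gen j) = h j.
Proof.
move=> he; pose fc i := projT1 (cid (cyclic_hom (e_gt0 i) (he i))).
have fcE i x : fc i x = (h (inl i) ^+ (x : nat))%g.
  exact: (projT2 (cid (cyclic_hom (e_gt0 i) (he i)))).
have [ff ffE] := free_hom (fun j => h (inr j)).
pose g j : {multiplicative factor j -> H} :=
  match j return {multiplicative factor j -> H} with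
  | Some i => fc i | None => ff end.
have [f fE] := free_prod_hom g; exists f => -[i|j] /=; rewrite fE /=; last exact: ffE.
rewrite fcE /=; have := he i; rewrite prednK //.
(* When [e i] is 1 the generator is the identity, and the hypothesis [he i] itself says that
   [h (inl i)] is trivial. *)
by case: (e i) (e_gt0 i) => [|[|k]] //= _; rewrite modnn expg0.
Qed.

Lemma cfp_gen_tors i : (cfp_gen (inl i) ^+ e i = 1)%g.
Proof.
rewrite -(multiplicativeX (free_prod_in (i := Some i))) cyclic_genX.
rewrite (_ : inZp (e i) = 1%g) ?(multiplicative1 (free_prod_in (i := Some i))) //.
by apply: val_inj; rewrite /= prednK ?modnn.
Qed.

End CyclicFreeProduct.

(** * The bound for the cyclic free product *)

HB.instance Definition _ (A : finComNzRingType) (h : {poly A}) :=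
  Finite.on {poly %/ h}.

Lemma geometric_sum_period (A : comNzRingType) (y : A) m n :
  y ^+ n = 1 -> \sum_(i < m * n) y ^+ i = m%:R * \sum_(i < n) y ^+ i.
Proof.
move=> yn; elim: m => [|m IHm]; first by rewrite mul0n big_ord0 mul0r.
rewrite mulSn big_split_ord /= mulrSr mulrDl mul1r addrC -IHm; congr (_ + _).
by apply: eq_bigr => i _; rewrite exprD yn mul1r.
Qed.

Lemma pdeficiency_le (R : realType) (p : nat) (p_pr : prime p) (s r : nat)
    (e : 'I_s -> nat) (e_gt0 : forall i : 'I_s, (0 < e i)%N) :
  (pdeficiency R p (cyclic_free_prod r e) <=
    (r%:R - 1 + \sum_(i < s) (1 - p%:R ^- logn p (e i)))%:E)%E.
Proof.
(* Any [N] that bounds every [l i] would serve; the sum is such a bound. *)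
pose l i := logn p (e i); pose N := (\sum_i l i)%N; pose Q := (p ^ N)%N.
have lN i : (l i <= N)%N by rewrite /N (bigD1 i) //= leq_addr.
have Q_gt0 : (0 < Q)%N by rewrite expn_gt0 prime_gt0.
pose hQ : {poly 'F_p} := 'X^Q.
have hQE : mk_monic hQ = 'X^Q by rewrite mk_monic_Xn prednK.
pose ev : {rmorphism {poly 'F_p} -> {poly %/ hQ}} := in_qpoly hQ.
have evXQ : ev 'X ^+ Q = 0.
  rewrite -rmorphXn; apply/val_inj; rewrite /= hQE.
  exact: (Pdiv.RingMonic.rmodpp (monicXn _ _)).
have ev_surj a : exists g, a = ev g.
  exists (val a); apply/val_inj; rewrite [RHS]in_qpoly_small //.
  exact: size_mk_monic.
have cardA : #|{poly %/ hQ}| = (p ^ Q)%N.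
  by rewrite card_qpoly hQE size_polyXn card_Fp.
have QE i : (p ^ (N - l i) * p ^ l i = Q)%N by rewrite -expnD subnK.
(* These are exponents of T modulo Q: Q/q_i with q_i = p^(l i) on the cyclic generators, which is
   killed by q_i and hence by e_i, and 0 on the free ones. *)
pose c (j : 'I_s + 'I_r) : 'I_Q.-1.+1 :=
  match j with inl i => inZp (p ^ (N - l i)) | inr _ => 1%g end.
have [chi chiE] : exists chi : {multiplicative cyclic_free_prod r e -> 'I_Q.-1.+1},
    forall j, chi (cfp_gen e j) = c j.
  apply: cfp_hom => // i; rewrite Zp_expg; apply/val_inj => /=.
  rewrite modnMml prednK // (divn_eq (e i) (p ^ l i)) (eqP (pfactor_dvdnn _ _)).
  by rewrite addn0 mulnCA QE modnMl.
pose a g := nat_of_ord (chi g).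
(* For a free generator [b] is Q and [t] is 0, so that [gam_dvd] compares x^Q = 0 with an empty
   sum. *)
pose b (j : 'I_s + 'I_r) := if j is inl i then (Q - p ^ (N - l i))%N else Q.
pose t (j : 'I_s + 'I_r) := if j is inl i then e i else 0%N.
have gam_tors j : (cfp_gen e j ^+ t j = 1)%g.
  by case: j => [i|j]; [exact: cfp_gen_tors|rewrite expg0].
have aM g h : a (g * h)%g = a g + a h %[mod Q].
  have valM (x y : 'I_Q.-1.+1) : nat_of_ord (x * y)%g = ((x + y) %% Q)%N.
    by rewrite /=; congr modn; exact: prednK.
  by rewrite /a gmulfM valM modn_mod.
have a1 : (Q %| a 1%g)%N by rewrite /a multiplicative1 dvdn0.
have gam_dvd j : exists z,
    ev 'X ^+ b j = z * \sum_(i < t j) ((1 + ev 'X) ^+ a (cfp_gen e j)) ^+ i.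
  case: j => [i|j]; last by exists 0; rewrite evXQ mul0r.
  (* With e_i = m q_i, the geometric sum of length e_i is m times the one of length q_i, and m is
     invertible modulo p. *)
  have [m p'm eE] := pfactor_coprime p_pr (e_gt0 i); rewrite -/(l i) in eE.
  have m_neq0 : m%:R != 0 :> 'F_p.
    by rewrite -(dvdn_pcharf (pchar_Fp p_pr)) -prime_coprime.
  exists (ev (m%:R^-1)%:P); rewrite /a chiE /= prednK //.
  rewrite (expr_mod _ (trunc_expQ p_pr evXQ)) eE geometric_sum_period; last first.
    by rewrite -exprM QE trunc_expQ.
  rewrite expr1D_pchar ?geometric_sum_pchar ?(trunc_pchar ev p_pr) //.
  rewrite mulrA -(rmorph_nat ev) -rmorphM -polyC_natr -polyCM mulVf //.
  rewrite polyC1 rmorph1 mul1r -exprM; congr (_ ^+ _).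
  by rewrite -subn1 mulnBr muln1 QE.
apply: ge_ereal_sup => _ [X [Rel [[f [f_surj f_ker]] ->]]].
have f_surj' g : exists w, f w = g.
  by have [w _ <-] : range f g; [rewrite f_surj | exists w].
have f_ker' w : f w = 1%g <-> normal_closure Rel w by rewrite -f_ker.
have [ws [ws_uniq wsR] bnd] := deficiency_bound p_pr evXQ ev_surj cardA f_surj'
  f_ker' a1 aM (@cfp_ind s r e) gam_tors gam_dvd R.
have Q_gt0R : (0 < Q%:R :> R) by rewrite ltr0n.
have bE : (\sum_j b j)%:R = Q%:R * (r%:R + \sum_(i < s) (1 - p%:R ^- l i)) :> R.
  rewrite big_sumType /= sum_nat_const card_ord natrD addrC natrM mulrC mulrDr.
  congr (_ + _); rewrite natr_sum mulr_sumr; apply: eq_bigr => i _.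
  rewrite natrB; last by rewrite leq_exp2l ?prime_gt1 // leq_subr.
  rewrite -{1 2}(QE i) !natrM !natrX mulrBr mulr1 mulfK //.
  by rewrite expf_neq0 // pnatr_eq0 -lt0n prime_gt0.
rewrite bE natrM -mulrDr ler_pM2l // in bnd.
(* The weights are nonnegative, so a finite subsum is enough, even if the full sum diverges. *)
have esum_ws : ((\sum_(w <- ws) pweight R p w)%:E <=
    \esum_(w in Rel) (pweight R p w)%:E)%E.
  apply: esum_ge; exists [set` ws]%classic; last by rewrite -sumEFin fsbig_seq.
  by split=> [|w /= /wsR]; first exact: finite_seq.
rewrite /pres_pdeficiency; apply: le_trans (leeB (lexx _) esum_ws) _.
rewrite -EFinB lee_fin; lra.
Qed.

(** * The standard presentation *)

Section PresentedGroup.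
Variables (X : choiceType) (Rel : set (free_group X)).
Local Notation fclass u := (word_class (W := free_system X) u).

Variant presented_rule : seq (X * bool) -> seq (X * bool) -> Prop :=
| PresentedFree u v of free_rule u v : presented_rule u v
| PresentedRel u of Rel (fclass u) : presented_rule u [::].

Let presented_mulgV a : word_congr presented_rule [:: a; free_inv a] [::].
Proof. exact/WCRule/PresentedFree/FreeCancel. Qed.

Let presented_mulVg a : word_congr presented_rule [:: free_inv a; a] [::].
Proof. by case: a => x []; exact: (presented_mulgV (x, _)). Qed.

Let presented_system := WordSystem presented_mulgV presented_mulVg.
Let pclass u := word_class (W := presented_system) u.

Lemma normal_closure_normal : normal_subgroup (normal_closure Rel).
Proof.
split=> [M [[]]//|x y Mx My M MP|x Mx M MP|x y Mx M MP].
- by have [_ MM _ _] := MP.1; apply: MM; [exact: (Mx M MP)|exact: (My M MP)].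
- by have [_ _ MV _] := MP.1; exact: (MV _ (Mx M MP)).
- by have [_ _ _ MJ] := MP.1; exact: (MJ _ _ (Mx M MP)).
Qed.

(** Being equal modulo the normal closure is itself a congruence containing the rules. *)
Lemma presented_congr u v : word_congr presented_rule u v ->
  normal_closure Rel (fclass u * (fclass v)^-1)%g.
Proof.
have [N1 NM NV NJ] := normal_closure_normal.
elim=> {u v} [u v [{}u {}v uv|{}u uR]|u|u v _|u v w _ uv _ vw|u u' v v' _ uu _ vv].
- have -> : fclass u = fclass v by apply/word_classP/WCRule.
  by rewrite mulgV.
- by rewrite word_class_nil invg1 mulg1 => M [_]; apply.
- by rewrite mulgV.
- by move/NV; rewrite invgM invgK.
- by rewrite -(mulgVK (fclass v) (fclass u)) -mulgA; apply: NM.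
(* Here u v (u' v')^-1 is the conjugate u (v v'^-1) u^-1 times u u'^-1. *)
- rewrite !word_class_cat invgM mulgA.
  rewrite -(mulgVK (fclass u) (fclass u * _ * _)%g) -[X in normal_closure _ X]mulgA.
  apply: NM => //; have := NJ _ (fclass u)^-1%g vv.
  by rewrite conjgE invgK !mulgA.
Qed.

Lemma presented_group_exists :
  exists (P : groupType) (pi : {multiplicative free_group X -> P}),
    forall w, pi w = 1%g <-> normal_closure Rel w.
Proof.
have [|pi piE] := @word_hom (free_system X) (word_group presented_system)
    (fun a => pclass [:: a]).
  move=> _ _ [a]; rewrite big_cons big_seq1 big_nil.
  by rewrite -word_class_cat; apply/word_classP/presented_mulgV.
have piC u : pi (fclass u) = pclass u.
  elim: u => [|a u IHu]; first by rewrite [LHS]multiplicative1.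
  by rewrite -cat1s [in LHS]word_class_cat gmulfM piE IHu -word_class_cat.
exists (word_group presented_system), pi => w; split=> [|].
  rewrite -(word_class_repr w) piC => /word_classP /presented_congr.
  by rewrite word_class_nil invg1 mulg1.
apply: (normal_closure_sub (kernel_normal pi)) => {}w Rw.
rewrite -(word_class_repr w) piC; apply/word_classP/WCRule/PresentedRel.
by rewrite word_class_repr.
Qed.

End PresentedGroup.

Section StandardPresentation.
Variables (s r : nat) (e : 'I_s -> nat).
Hypothesis e_gt0 : forall i, (0 < e i)%N.
Local Notation X := ('I_s + 'I_r)%type.

Definition cfp_relator (i : 'I_s) : free_group X := (free_gen (inl i : X) ^+ e i)%g.

(** The relators hold in the presented group, so the universal property of the free product gives
    [h] with [h] after [f] equal to [pi]. The kernel of [f] is thus contained in that of [pi], which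
    is the normal closure. *)
Lemma cfp_presentation :
  is_presentation (cyclic_free_prod r e) (range cfp_relator).
Proof.
have [f fE] := free_hom (@cfp_gen s r e).
have [P [pi piP]] := presented_group_exists (range cfp_relator).
have [i|h hE] := cfp_hom e_gt0 (h := fun j : X => pi (free_gen j)).
  rewrite -multiplicativeX; apply/piP => M [_]; apply.
  by exists i.
have hf w : h (f w) = pi w.
  elim/free_ind: w => [|u v IHu IHv|u IHu|j]; rewrite ?multiplicative1 //.
  - by rewrite !gmulfM IHu IHv.
  - by rewrite !multiplicativeV IHu.
  - by rewrite fE hE.
exists f; split; apply/seteqP; split=> w //=.
- move=> _; move: w; apply: cfp_ind => [|_ _ [u _ <-] [v _ <-]|_ [u _ <-]|j].
  + by exists 1%g; rewrite ?multiplicative1.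
  + by exists (u * v)%g; rewrite ?gmulfM.
  + by exists u^-1%g; rewrite ?multiplicativeV.
  + by exists (free_gen j); rewrite ?fE.
- by move=> fw; apply/piP; rewrite -hf fw multiplicative1.
- apply: (normal_closure_sub (kernel_normal f)) => _ [i _ <-].
  by rewrite /= multiplicativeX fE cfp_gen_tors.
Qed.

(** [phi] is the exponent sum of the i-th generator modulo p^n. It serves to show that the relators
    are nontrivial and distinct, and to bound their p-valuations. *)
Lemma cfp_relator_detect (p : nat) (i : 'I_s) (n : nat) : (0 < p)%N ->
  exists phi : {multiplicative free_group X -> 'I_(p ^ n).-1.+1},
    phi (cfp_relator i) = inZp (e i) /\
    forall j, j != i -> phi (cfp_relator j) = 1%g.
Proof.
move=> p_gt0; have [phi phiE] := free_hom (fun j : X =>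
  if j == inl i then inZp 1 else 1%g : 'I_(p ^ n).-1.+1).
exists phi; rewrite /cfp_relator; split=> [|j ji].
  by rewrite multiplicativeX phiE eqxx Zp_expg; apply/val_inj; rewrite /= modnMml mul1n.
by rewrite multiplicativeX phiE (inj_eq inl_inj) (negPf ji) expg1n.
Qed.

End StandardPresentation.

(** * Weights of the standard relators and the lower bound *)

Section RelatorWeights.
Variables (p s r : nat) (e : 'I_s -> nat).
Hypotheses (p_pr : prime p) (e_gt0 : forall i, (0 < e i)%N).
Local Notation relator := (cfp_relator r e).

Let relator_image_neq1 i : inZp (e i) != 1%g :> 'I_(p ^ (logn p (e i)).+1).-1.+1.
Proof.
apply/eqP => /(congr1 val) /= /eqP.
by rewrite prednK ?expn_gt0 ?prime_gt0 // -/(dvdn _ _) pfactor_dvdn // ltnn.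
Qed.

Lemma cfp_relator_neq1 i : relator i != 1%g.
Proof.
have [phi [phii _]] := cfp_relator_detect r e i (logn p (e i)).+1 (prime_gt0 p_pr).
by apply: contraNneq (relator_image_neq1 i) => ri; rewrite -phii ri multiplicative1.
Qed.

Lemma cfp_relator_inj : injective relator.
Proof.
move=> i j rij; apply/eqP/negPn/negP => ji.
have [phi [phii phij]] :=
  cfp_relator_detect r e i (logn p (e i)).+1 (prime_gt0 p_pr).
by case/eqP: (relator_image_neq1 i); rewrite -phii rij phij // eq_sym.
Qed.

(** A p^j-th root with j > nu_p(e_i) would force e_i = 0 modulo p^(nu_p(e_i) + 1). Since nu_p(e_i)
    is attained, the maximum exists and [xget] does not return its default. *)
Lemma pvaluation_cfp_relator i : pvaluation p (relator i) = logn p (e i).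
Proof.
have root_le j : (exists v, relator i = v ^+ (p ^ j))%g -> (j <= logn p (e i))%N.
  move=> [v rv]; rewrite leqNgt; apply/negP => lj.
  have [phi [phii _]] := cfp_relator_detect r e i (logn p (e i)).+1 (prime_gt0 p_pr).
  case/eqP: (relator_image_neq1 i); rewrite -phii rv multiplicativeX Zp_expg.
  case: (phi v) => x x_lt; apply/val_inj.
  rewrite /= prednK ?expn_gt0 ?prime_gt0 //; apply/eqP.
  by rewrite -/(dvdn _ _) dvdn_mull // dvdn_exp2l.
have root_logn : exists v, (relator i = v ^+ (p ^ logn p (e i)))%g.
  have [m _ eE] := pfactor_coprime p_pr (e_gt0 i).
  by exists (free_gen (inl i) ^+ m)%g; rewrite -expgnA -eE.
rewrite /pvaluation; case: xgetP => [k _ [rk kmax]|none].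
  by apply/eqP; rewrite eqn_leq root_le // kmax.
by case: (none (logn p (e i))).
Qed.

End RelatorWeights.

Lemma pdeficiency_ge (R : realType) (p : nat) (p_pr : prime p) (s r : nat)
    (e : 'I_s -> nat) (e_gt0 : forall i : 'I_s, (0 < e i)%N) :
  ((r%:R - 1 + \sum_(i < s) (1 - p%:R ^- logn p (e i)))%:E <=
    pdeficiency R p (cyclic_free_prod r e))%E.
Proof.
apply: ereal_sup_ubound.
exists ('I_s + 'I_r)%type, (range (cfp_relator r e)).
split; first exact: cfp_presentation.
rewrite /pres_pdeficiency.
(* The left side runs over the set of relators; injectivity of [cfp_relator] makes every index count
   once. *)
have -> : (\esum_(w in range (cfp_relator r e)) (pweight R p w)%:E =
    (\sum_(i < s) (p%:R ^- logn p (e i)))%:E)%E.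
  have rangeE : range (cfp_relator r e) = 
      [set` [seq cfp_relator r e i | i <- enum 'I_s]]%classic.
    apply/seteqP; split=> [_ [i _ <-]|w /= /mapP[i _ ->]]; last by exists i.
    by apply/mapP; exists i; rewrite ?mem_enum.
  rewrite rangeE esum_fset; last 2 first.
  - exact: finite_seq.
  - by move=> w _; rewrite lee_fin pweight_ge0.
  rewrite -fsbig_seq /=; last first.
    by rewrite map_inj_uniq ?enum_uniq //; apply: (cfp_relator_inj p_pr e_gt0).
  rewrite big_map big_enum sumEFin; congr (_%:E); apply: eq_bigr => i _.
  by rewrite /pweight (negPf (cfp_relator_neq1 r p_pr e_gt0 i)) pvaluation_cfp_relator.
rewrite -EFinB card_sum !card_ord sumrB sumr_const card_ord natrD.
by congr (_%:E); lra.
Qed.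

Unset Implicit Arguments.

Theorem corollary13 (R : realType) (p : nat) (hp : prime p) (s r : nat)
    (e : 'I_s -> nat) (he : forall i : 'I_s, (0 < e i)%N) :
  pdeficiency R p (cyclic_free_prod r e) =
    (r%:R - 1 + \sum_(i < s) (1 - p%:R ^- logn p (e i)))%:E.
Proof. by apply/eqP; rewrite eq_le pdeficiency_le // pdeficiency_ge. Qed.
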